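(* Let $n\ge 4$ and let $P_n$ be the path graph with $n$ edges and $n+1$ vertices. The complex $\mathcal{SM}(P_n)$ of strong discrete Morse matchings on $P_n$ has the following homotopy type: $$\mathcal{SM}(P_n)\simeq \begin{cases}\mathbb{S}^{2k-1} & \text{if } n=4k,\\ \mathbb{S}^{2k} & \text{if } n=4k+1,\\ \ast & \text{if } n=4k+2 \text{ or } n=4k+3,\end{cases}$$ where $\ast$ denotes a point.
   Context: All simplicial complexes are finite. For a simplicial complex $K$ and a vertex $v$, the link $\mathrm{lk}(v,K)$ consists of the simplices $\sigma$ of $K$ with $v\notin\sigma$ and $\sigma\cup\{v\}\in K$. A vertex $v$ is dominated by a vertex $a\ne v$ in $K$ if $\mathrm{lk}(v,K)=a*K_0$ is a simplicial cone with apex $a$ (over a possibly empty subcomplex $K_0$). A vertex filtration is an injective map $g:V(K)\to\mathbb{R}$; $K_{g(v)}$ denotes the full subcomplex of $K$ on the vertices $w$ with $g(w)\le g(v)$. The vertex $v$ is descending dominated by $a$ if $v$ is dominated by $a$ in $K_{g(v)}$ (so $g(a)<g(v)$). A strong Morse matching associated with $g$ is obtained by choosing, for every descending dominated vertex $v$, one vertex $a_v$ dominating it in $K_{g(v)}$, and taking the set of all pairs $(\sigma,\sigma\cup\{a_v\})$ where $\sigma$ is a simplex of $K_{g(v)}$ with $v\in\sigma$ and $a_v\notin\sigma$; vertices that are not descending dominated contribute no pairs. A strong Morse matching on $K$ is one associated with some vertex filtration (and some choices). The complex $\mathcal{SM}(K)$ is the simplicial complex whose simplices are all nonempty subsets of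 strong Morse matchings on $K$ (so its vertices are the pairs $(\sigma,\tau)$, $\sigma$ a codimension-one face of $\tau$, occurring in some strong Morse matching). *)

(* Defs.v *)
From mathcomp Require Import all_boot all_order all_algebra.
From mathcomp Require Import all_classical all_reals all_analysis.

Set Implicit Arguments.
Unset Strict Implicit.
Unset Printing Implicit Defensive.

Import Order.TTheory GRing.Theory Num.Theory.
Import numFieldNormedType.Exports.

Local Open Scope classical_set_scope.
Local Open Scope ring_scope.

(* The empty set is not a simplex. Elements of V need not be vertices: V(K)   *)
(* consists of the v such that {v} is a simplex of K.                         *)
Record scomplex (V : finType) := SComplex {
  simplex :> {set V} -> Prop;
  simplex_neq0 : forall s, simplex s -> s != finset.set0;
  simplex_face : forall s t : {set V},
    simplex s -> t \subset s -> t != finset.set0 -> simplex t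
}.

Section Domination.
Context {V : finType}.
Implicit Types (K : scomplex V) (v a : V).

Definition vertex K v : Prop := K [set v]%SET.

Definition link v K : set {set V} :=
  [set s | [/\ K s, v \notin s & K (v |: s)%SET]].

Definition cone a K : set {set V} :=
  [set s | [\/ s = [set a]%SET, K s | exists2 t, K t & s = (a |: t)%SET]].

(* K0 may have no simplices. It is a subcomplex of K because it is contained  *)
(* in the link; a is not a vertex of the base of the cone a * K0.             *)
Definition dominated K v a : Prop :=
  a != v /\ exists K0 : scomplex V, ~ vertex K0 a /\ link v K = cone a K0.

End Domination.

Section Sublevel.
Context {R : realType} {V : finType}.
Variables (K : scomplex V) (g : V -> R) (v : V).

Definition sublevel_simplex (s : {set V}) : Prop :=
  K s /\ forall w, w \in s -> g w <= g v.

Lemma sublevel_neq0 s : sublevel_simplex s -> s != finset.set0.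
Proof. by case=> /simplex_neq0. Qed.

Lemma sublevel_face (s t : {set V}) : sublevel_simplex s -> t \subset s ->
  t != finset.set0 -> sublevel_simplex t.
Proof.
case=> Ks gs ts t0; split; first exact: simplex_face Ks ts t0.
by move=> w /(fintype.subsetP ts); exact: gs.
Qed.

Definition sublevel : scomplex V := SComplex sublevel_neq0 sublevel_face.

End Sublevel.

Section StrongMorse.
Context {R : realType} {V : finType}.
Implicit Types (K : scomplex V) (g : V -> R) (v a : V).

(* Only the values of g on V(K) are relevant. *)
Definition vertex_filtration K g : Prop :=
  forall v w, vertex K v -> vertex K w -> g v = g w -> v = w.

Definition descending_dominated_by K g v a : Prop :=
  dominated (sublevel K g v) v a.

Definition descending_dominated K g v : Prop :=
  exists a, descending_dominated_by K g v a.

(* c v is the chosen vertex a_v; its value is irrelevant when v is not        *)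
(* descending dominated.                                                      *)
Definition associated_matching K g (c : V -> V)
    (M : {set {set V} * {set V}}) : Prop :=
  (forall v, descending_dominated K g v -> descending_dominated_by K g v (c v))
  /\ [set` M] = [set p | exists v (s : {set V}),
       [/\ descending_dominated K g v, sublevel K g v s, v \in s, c v \notin s
         & p = (s, (c v |: s)%SET)]].

End StrongMorse.

Definition strong_Morse_matching (R : realType) (V : finType)
    (K : scomplex V) (M : {set {set V} * {set V}}) : Prop :=
  exists (g : V -> R) (c : V -> V),
    vertex_filtration K g /\ associated_matching K g c M.

Section SM.
Variables (R : realType) (V : finType) (K : scomplex V).

Definition SM_simplex (S : {set {set V} * {set V}}) : Prop :=
  S != finset.set0 /\ exists2 M, strong_Morse_matching R K M & S \subset M.

Lemma SM_neq0 S : SM_simplex S -> S != finset.set0.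
Proof. by case. Qed.

Lemma SM_face (S T : {set {set V} * {set V}}) : SM_simplex S ->
  T \subset S -> T != finset.set0 -> SM_simplex T.
Proof.
case=> _ [M MK SM] TS T0; split=> //; exists M => //.
exact: fintype.subset_trans TS SM.
Qed.

Definition SM : scomplex ({set V} * {set V})%type := SComplex SM_neq0 SM_face.

End SM.

Section PathGraph.
Variable n : nat.

Definition path_simplex (s : {set 'I_n.+1}) : Prop :=
  (exists i, s = [set i]%SET) \/
  (exists i j : 'I_n.+1, j = i.+1 :> nat /\ s = [set i; j]%SET).

Lemma path_neq0 s : path_simplex s -> s != finset.set0.
Proof.
case=> [[i ->]|[i [j [_ ->]]]]; apply/finset.set0Pn; exists i.
  exact: finset.set11.
exact: finset.set21.
Qed.

Lemma path_face (s t : {set 'I_n.+1}) : path_simplex s -> t \subset s ->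
  t != finset.set0 -> path_simplex t.
Proof.
case=> [[i ->]|[i [j [ij ->]]]].
  by rewrite finset.subset1 => /orP[/eqP ->|/eqP ->]; [left; exists i|rewrite eqxx].
move=> /fintype.subsetP ts /finset.set0Pn[k kt].
have [it|it] := boolP (i \in t); have [jt|jt] := boolP (j \in t).
- right; exists i, j; split=> //; apply/finset.setP => x.
  apply/idP/idP; first exact: ts.
  by rewrite !finset.inE => /orP[] /eqP ->.
- left; exists i; apply/finset.setP => x; rewrite finset.inE.
  apply/idP/idP => [xt|/eqP -> //]; move: (ts x xt); rewrite !finset.inE.
  by case/orP => // /eqP xj; rewrite -xj xt in jt.
- left; exists j; apply/finset.setP => x; rewrite finset.inE.
  apply/idP/idP => [xt|/eqP -> //]; move: (ts x xt); rewrite !finset.inE.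
  by case/orP => // /eqP xi; rewrite -xi xt in it.
- move: (ts k kt); rewrite !finset.inE.
  by case/orP => /eqP e; rewrite -e kt in it jt.
Qed.

Definition path_graph : scomplex 'I_n.+1 := SComplex path_neq0 path_face.

End PathGraph.

(* Barycentric coordinates; {ptws V -> R} carries the product topology, which *)
(* is the Euclidean one since V is finite.                                    *)
Definition realization (R : realType) (V : finType) (K : scomplex V) :
    set {ptws V -> R} :=
  [set x | [/\ forall v, 0 <= x v, \sum_(v : V) x v = 1
             & K (finset [pred v | x v != 0])]].

Arguments realization R {V} K.

Definition sphere (R : realType) (m : nat) : set 'rV[R]_m.+1 :=
  [set x | \sum_(i < m.+1) x ord0 i ^+ 2 = 1].

Arguments sphere R m : clear implicits.

Section Homotopy.
Variable R : realType.

Definition homotopic (X Y : topologicalType) (f g : X -> Y) : Prop :=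
  exists H : X * R -> Y,
    [/\ {within [set: X] `*` `[0, 1], continuous H},
        forall x, H (x, 0) = f x & forall x, H (x, 1) = g x].

Definition homotopy_equivalent (X Y : topologicalType) : Prop :=
  exists (f : X -> Y) (h : Y -> X),
    [/\ continuous f, continuous h, homotopic (h \o f) id
      & homotopic (f \o h) id].

End Homotopy.

(* Main.v *)
(* Write L_i for the pair ({i+1}, {i,i+1}) and R_i for the pair ({i}, {i,i+1}).
   A vertex of a path is descending dominated exactly when it has a unique lower
   neighbour, so a strong Morse matching is determined by an arbitrary orientation
   of the edges. Hence SM(P_n) is the independence complex of the bipartite graph
   on the L_i and R_j (0 <= i, j < n) with L_i adjacent to R_j if and only if
   i <= j <= i+2. Folding dominated vertices from the left moves R_{4q+1} and
   R_{4q+2} to R_{4q}, then L_{4q+2} and L_{4q+3} to L_{4q+1}, through a chain of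
   contiguous vertex maps. If n = 4k or 4k+1, the image is the boundary of the
   crosspolytope with antipodal pairs (L_{4q}, R_{4q}) and (L_{4q+1}, R_{4q+3}).
   If n = 4k+2 or 4k+3, the vertex L_{4k+1} is isolated in the graph induced on
   the image, which is therefore a cone. *)

Require Import Defs.
From mathcomp Require Import all_boot all_order all_algebra.
From mathcomp Require Import all_classical all_reals all_analysis.
From mathcomp Require Import zify ring lra.

Set Implicit Arguments.
Unset Strict Implicit.
Unset Printing Implicit Defensive.

Import Order.TTheory GRing.Theory Num.Theory.
Import numFieldNormedType.Exports.

Local Open Scope classical_set_scope.
Local Open Scope ring_scope.

(** * Continuity and homotopies *)

Section Continuity.
Variable R : realType.

Lemma continuous_to_set_type (X Y : topologicalType) (A : set Y) (f : X -> A) :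
  continuous (fun x => \val (f x)) -> continuous f.
Proof. by move=> cf; apply: continuous_comp_initial. Qed.

Lemma continuous_val (Y : topologicalType) (A : set Y) :
  continuous (fun x : A => \val x).
Proof. exact: initial_continuous. Qed.

Lemma continuous_to_ptws (X : topologicalType) (V : Type) (f : X -> {ptws V -> R}) :
  (forall v, continuous (fun x => f x v)) -> continuous f.
Proof.
move=> cf x; apply/cvg_sup => v; rewrite cvg_image; last first.
  (* Constant functions witness that evaluation at [v] is onto. *)
  by rewrite eqEsubset; split=> w // _; exists (cst w).
move=> W /= /cf fW; exists (@^~ v @^-1` W) => //.
by rewrite eqEsubset; split=> [w [? + <-]//|w Ww]; exists (cst w).
Qed.

Lemma continuous_ptws_eval (V : eqType) (v : V) :
  continuous (fun x : {ptws V -> R} => x v).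
Proof. exact: proj_continuous. Qed.

Lemma continuous_sumr (X : topologicalType) (I : Type) (r : seq I) (P : pred I)
    (f : I -> X -> R) : (forall i, P i -> continuous (f i)) ->
  continuous (fun x => \sum_(i <- r | P i) f i x).
Proof. apply: continuous_big; exact: add_continuous. Qed.

Lemma continuous_to_rV (X : topologicalType) (m : nat) (f : X -> 'rV[R]_m.+1) :
  (forall i, continuous (fun x => f x ord0 i)) -> continuous f.
Proof.
move=> cf; have -> : f = fun x => \sum_(j < m.+1) f x ord0 j *: 'e_j.
  by apply/funext => x; rewrite -row_sum_delta.
apply: continuous_big; first exact: add_continuous.
by move=> i _ x; apply: continuousZl; apply: cf.
Qed.

Lemma continuous_addr (X : topologicalType) (f g : X -> R) :
  continuous f -> continuous g -> continuous (fun x => f x + g x).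
Proof. by move=> cf cg x; apply: cvgD; [exact: cf|exact: cg]. Qed.

Lemma continuous_mulr (X : topologicalType) (f g : X -> R) :
  continuous f -> continuous g -> continuous (fun x => f x * g x).
Proof. by move=> cf cg x; apply: cvgM; [exact: cf|exact: cg]. Qed.

Lemma continuous_invr (X : topologicalType) (f : X -> R) :
  (forall x, f x != 0) -> continuous f -> continuous (fun x => (f x)^-1).
Proof. by move=> f0 cf x; apply: cvgV; [exact: f0|exact: cf]. Qed.

(** Retracts time onto the unit interval, so that a segment that stays in a realization only for
    times in [0, 1] yields a homotopy defined on all of [R]. *)
Definition clamp (t : R) : R := Num.min (Num.max t 0) 1.

Lemma clamp_itv t : 0 <= clamp t <= 1.
Proof. by rewrite /clamp le_min ler01 le_max lexx orbT ge_min lexx orbT. Qed.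

Lemma clamp_id t : 0 <= t <= 1 -> clamp t = t.
Proof. by case/andP => t0 t1; rewrite /clamp max_l // min_l. Qed.

Lemma continuous_clamp : continuous clamp.
Proof.
move=> x; have -> : clamp = ((id \max cst 0) \min cst 1 : R -> R^o) by [].
apply: continuous_min; last exact: cvg_cst.
by apply: continuous_max; [exact: cvg_id|exact: cvg_cst].
Qed.

Lemma continuous_pair (X Y Z : topologicalType) (f : X -> Y) (g : X -> Z) :
  continuous f -> continuous g -> continuous (fun x => (f x, g x)).
Proof. by move=> cf cg x; exact: (cvg_pair (cf x) (cg x)). Qed.

Lemma continuous_fst (X Y : topologicalType) : continuous (@fst X Y).
Proof. by move=> p; exact: cvg_fst. Qed.

Lemma continuous_snd (X Y : topologicalType) : continuous (@snd X Y).
Proof. by move=> p; exact: cvg_snd. Qed.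

(** Continuity on the whole product, rather than within a strip, keeps subspace topologies out of
    the composition of homotopies. *)
Definition globally_homotopic (X Y : topologicalType) (f g : X -> Y) : Prop :=
  exists H : X * R -> Y,
    [/\ continuous H, forall x, H (x, 0) = f x & forall x, H (x, 1) = g x].

Lemma globally_homotopic_homotopic (X Y : topologicalType) (f g : X -> Y) :
  globally_homotopic f g -> homotopic R f g.
Proof.
by case=> H [cH H0 H1]; exists H; split=> //; apply: continuous_subspaceT.
Qed.

Lemma globally_homotopic_refl (X Y : topologicalType) (f : X -> Y) :
  continuous f -> globally_homotopic f f.
Proof.
move=> cf; exists (f \o fst); split=> // p.
by apply: continuous_comp; [exact: continuous_fst|exact: cf].
Qed.

Lemma globally_homotopic_sym (X Y : topologicalType) (f g : X -> Y) :
  globally_homotopic f g -> globally_homotopic g f.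
Proof.
case=> H [cH H0 H1]; exists (fun p => H (p.1, 1 - p.2)); split; last 2 first.
- by move=> x; rewrite /= subr0.
- by move=> x; rewrite /= subrr.
move=> p; apply: (continuous_comp (f := fun p : X * R => (p.1, 1 - p.2))); last exact: cH.
apply: continuous_pair p; first exact: continuous_fst.
by move=> p; apply: cvgB; [exact: cvg_cst|exact: cvg_snd].
Qed.

(** Both homotopies run at double speed and are pasted along the closed sets of times at most,
    respectively at least, one half. *)
Lemma globally_homotopic_trans (X Y : topologicalType) (f g h : X -> Y) :
  globally_homotopic f g -> globally_homotopic g h -> globally_homotopic f h.
Proof.
case=> H1 [cH1 H10 H11] [H2 [cH2 H20 H21]].
pose G (p : X * R) := if p.2 <= 2^-1 then H1 (p.1, 2 * p.2) else H2 (p.1, 2 * p.2 - 1).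
have cs (a : R) : continuous (fun p : X * R => (p.1, 2 * p.2 + a)).
  apply: continuous_pair; first exact: continuous_fst.
  move=> p; apply: cvgD; last exact: cvg_cst.
  by apply: cvgM; [exact: cvg_cst|exact: cvg_snd].
exists G; split; last 2 first.
- by move=> x; rewrite /G /= mulr0 invr_ge0 ler0n.
- move=> x; rewrite /G /= mulr1 ifF; last by apply/negbTE; rewrite -ltNge; lra.
  by have -> : 2 - 1 = 1 :> R by ring.
have cG : {within (snd @^-1` [set t | t <= 2^-1]) `|` (snd @^-1` [set t | 2^-1 <= t]),
    continuous G}.
  apply: withinU_continuous.
  - by apply: preimage_closed; [by move=> p _; exact: continuous_snd|exact: closed_le].
  - by apply: preimage_closed; [by move=> p _; exact: continuous_snd|exact: closed_ge].
  - apply: (@subspace_eq_continuous _ _ _ (fun p : X * R => H1 (p.1, 2 * p.2 + 0))).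
      by move=> p /set_mem pl; rewrite /G /from_subspace addr0 ifT.
    by apply: continuous_subspaceT => p; apply: continuous_comp; [exact: cs|exact: cH1].
  - apply: (@subspace_eq_continuous _ _ _ (fun p : X * R => H2 (p.1, 2 * p.2 - 1))).
      move=> p /set_mem pl; rewrite /G /from_subspace; case: ifP => // pr.
      (* On the overlap the first homotopy has ended and the second one starts, so both give [g]. *)
      have -> : p.2 = 2^-1 by apply/eqP; rewrite eq_le pl pr.
      by rewrite divff ?pnatr_eq0 // subrr H20 H11.
    by apply: continuous_subspaceT => p; apply: continuous_comp; [exact: cs|exact: cH2].
have E : (snd @^-1` [set t | t <= 2^-1]) `|` (snd @^-1` [set t | 2^-1 <= t]) = [set: X * R].
  by apply/seteqP; split=> // p _; case: (leP p.2 2^-1) => [|/ltW]; [left|right].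
by rewrite E in cG; apply/continuous_subspace_setT.
Qed.

End Continuity.

(** * Realizations of vertex maps *)

Definition contiguous (V W : finType) (K : scomplex V) (L : scomplex W)
    (phi psi : V -> W) : Prop :=
  forall s : {set V}, K s -> L ((phi @: s) :|: (psi @: s))%SET.

Definition simplicial (V W : finType) (K : scomplex V) (L : scomplex W)
    (phi : V -> W) : Prop :=
  forall s : {set V}, K s -> L (phi @: s)%SET.

Lemma imset_simplex_neq0 (V W : finType) (K : scomplex V) (phi : V -> W)
    (s : {set V}) : K s -> (phi @: s)%SET != finset.set0.
Proof. by move=> /simplex_neq0; rewrite imset_eq0. Qed.

Lemma contiguous_simplicial (V W : finType) (K : scomplex V) (L : scomplex W)
    (phi psi : V -> W) : contiguous K L phi psi -> simplicial K L phi.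
Proof.
move=> c s Ks; apply: simplex_face (c s Ks) _ (imset_simplex_neq0 phi Ks).
exact: finset.subsetUl.
Qed.

Lemma contiguous_sym (V W : finType) (K : scomplex V) (L : scomplex W)
    (phi psi : V -> W) : contiguous K L phi psi -> contiguous K L psi phi.
Proof. by move=> c s Ks; rewrite finset.setUC; exact: c. Qed.

Lemma simplicial_contiguous (V W : finType) (K : scomplex V) (L : scomplex W)
    (phi : V -> W) : simplicial K L phi -> contiguous K L phi phi.
Proof. by move=> c s Ks; rewrite finset.setUid; exact: c. Qed.

(** Vertex maps are total on a type whose elements need not be vertices, so two maps to be
    identified may differ outside the simplices. *)
Lemma contiguous_eq (V W : finType) (A : scomplex V) (B : scomplex W)
    (phi psi : V -> W) : simplicial A B phi ->
  (forall s v, A s -> v \in s -> phi v = psi v) -> contiguous A B phi psi.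
Proof.
move=> phiS e s As; have -> : (psi @: s = phi @: s)%SET.
  by apply: eq_in_imset => v vs; rewrite (e s).
by rewrite finset.setUid; exact: phiS.
Qed.

Lemma simplicial_id (V : finType) (A : scomplex V) : simplicial A A id.
Proof. by move=> s; rewrite imset_id. Qed.

Section RealizationMap.
Variable R : realType.

Definition push_coords (V W : finType) (phi : V -> W) (x : {ptws V -> R}) :
    {ptws W -> R} := fun w => \sum_(v | phi v == w) x v.

Definition segment (V : finType) (x y : {ptws V -> R}) (t : R) : {ptws V -> R} :=
  fun v => (1 - t) * x v + t * y v.

Lemma segment0 (V : finType) (x y : {ptws V -> R}) : segment x y 0 = x.
Proof. by apply/funext => v; rewrite /segment subr0 mul1r mul0r addr0. Qed.

Lemma segment1 (V : finType) (x y : {ptws V -> R}) : segment x y 1 = y.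
Proof. by apply/funext => v; rewrite /segment subrr mul1r mul0r add0r. Qed.

Lemma continuous_push_coords (V W : finType) (phi : V -> W) :
  continuous (push_coords phi).
Proof.
apply: continuous_to_ptws => w; apply: continuous_sumr => v _.
exact: continuous_ptws_eval.
Qed.

Lemma sum_push_coords (V W : finType) (phi : V -> W) (x : {ptws V -> R}) :
  \sum_w push_coords phi x w = \sum_v x v.
Proof. by rewrite [RHS](partition_big phi predT). Qed.

Lemma realization_of_subsupport (V : finType) (K : scomplex V) (s : {set V})
    (x : {ptws V -> R}) : K s -> (forall v, 0 <= x v) -> \sum_v x v = 1 ->
  (forall v, v \notin s -> x v = 0) -> realization R K x.
Proof.
move=> Ks x0 x1 xs; split=> //; apply: simplex_face Ks _ _.
  apply/fintype.subsetP => v; rewrite !inE; apply: contraR => /xs ->.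
  by rewrite eqxx.
apply/negP => /eqP e; move: x1; rewrite big1 => [/esym/eqP|v _].
  by rewrite oner_eq0.
by apply/eqP; move/setP: e => /(_ v); rewrite !inE => /negbFE.
Qed.

(** If [s] is the support of [x], both endpoints are supported in the union of [phi @: s] and
    [psi @: s], a simplex by contiguity; the segment between them stays in it. *)
Lemma segment_push_coords_realization (V W : finType) (K : scomplex V)
    (L : scomplex W) (phi psi : V -> W) (x : {ptws V -> R}) (t : R) :
  contiguous K L phi psi -> 0 <= t <= 1 -> realization R K x ->
  realization R L (segment (push_coords phi x) (push_coords psi x) t).
Proof.
move=> c /andP[t0 t1] [x0 x1 xK].
apply: (realization_of_subsupport (c _ xK)).
- by move=> w; rewrite addr_ge0 // mulr_ge0 ?subr_ge0 // sumr_ge0.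
- by rewrite big_split /= -!mulr_sumr !sum_push_coords x1; ring.
- move=> w; rewrite finset.in_setU => /norP[wphi wpsi].
  rewrite /segment /push_coords !big1 ?mulr0 ?addr0 // => v /eqP vw; apply/eqP.
    by apply: contraR wpsi => xv; rewrite -vw imset_f // !inE.
  by apply: contraR wphi => xv; rewrite -vw imset_f // !inE.
Qed.

Lemma push_coords_realization (V W : finType) (K : scomplex V)
    (L : scomplex W) (phi : V -> W) (x : {ptws V -> R}) :
  simplicial K L phi -> realization R K x ->
  realization R L (push_coords phi x).
Proof.
move=> /simplicial_contiguous c xK.
(* A simplicial map is contiguous to itself, so this is time 0 of a constant segment. *)
rewrite -[push_coords _ _](segment0 _ (push_coords phi x)).
by apply: segment_push_coords_realization xK; rewrite ?lexx ?ler01.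
Qed.

Definition realization_map (V W : finType) (K : scomplex V) (L : scomplex W)
    (phi : V -> W) (phiS : simplicial K L phi) (x : realization R K) :
    realization R L :=
  SigSub (mem_set (push_coords_realization phiS (set_valP x))).

Lemma continuous_realization_map (V W : finType) (K : scomplex V)
    (L : scomplex W) (phi : V -> W) (phiS : simplicial K L phi) :
  continuous (realization_map phiS).
Proof.
apply: continuous_to_set_type => x; apply: continuous_comp.
  exact: continuous_val.
exact: continuous_push_coords.
Qed.

Lemma realization_map_comp (V W Z : finType) (K : scomplex V) (L : scomplex W)
    (M : scomplex Z) (phi : V -> W) (psi : W -> Z) (phiS : simplicial K L phi)
    (psiS : simplicial L M psi) (compS : simplicial K M (psi \o phi)) :
  realization_map psiS \o realization_map phiS = realization_map compS.
Proof.
apply/funext => x; apply/val_inj/funext => z /=; rewrite /push_coords.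
rewrite [RHS](partition_big phi (fun w => psi w == z)) //=.
apply: eq_bigr => w /eqP pw; apply: eq_bigl => v.
by case: eqP => [->|]; rewrite ?andbT ?andbF // pw eqxx.
Qed.

Lemma realization_map_id (V : finType) (K : scomplex V) (phi : V -> V)
    (phiS : simplicial K K phi) : (forall s v, K s -> v \in s -> phi v = v) ->
  realization_map phiS = id.
Proof.
move=> phi_id; apply/funext => x; apply/val_inj/funext => w /=.
have [_ _ xK] := set_valP x.
have idx v : \val x v != 0 -> phi v = v by move=> xv; apply: phi_id xK _; rewrite !inE.
rewrite /push_coords big_mkcond (bigD1 w) //= big1 ?addr0 => [|v vw].
  have [->|/idx ->] := eqVneq (\val x w) 0; first by case: ifP.
  by rewrite eqxx.
by case: eqP => // pv; apply/eqP; apply: contraNT vw => /idx <-; exact/eqP.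
Qed.

(** The homotopy is the straight line between the two images of each point, with clamped time. *)
Lemma contiguous_homotopic (V W : finType) (K : scomplex V) (L : scomplex W)
    (phi psi : V -> W) (phiS : simplicial K L phi) (psiS : simplicial K L psi) :
  contiguous K L phi psi ->
  globally_homotopic R (realization_map phiS) (realization_map psiS).
Proof.
move=> c.
pose H (p : realization R K * R) : realization R L :=
  SigSub (mem_set (segment_push_coords_realization c (clamp_itv p.2) (set_valP p.1))).
exists H; split; last 2 first.
- by move=> x; apply/val_inj; rewrite /= clamp_id ?lexx ?ler01 // segment0.
- by move=> x; apply/val_inj; rewrite /= clamp_id ?lexx ?ler01 // segment1.
apply: continuous_to_set_type; apply: continuous_to_ptws => w.
have ct : continuous (fun p : realization R K * R => clamp p.2).
  by move=> p; apply: continuous_comp; [exact: continuous_snd|exact: continuous_clamp].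
have cp (f : V -> W) :
    continuous (fun p : realization R K * R => push_coords f (\val p.1) w).
  move=> p; apply: (@continuous_comp _ _ _ (fun p : realization R K * R => \val p.1)
      (fun y => push_coords f y w)).
    apply: (@continuous_comp _ _ _ fst (fun x : realization R K => \val x)).
      exact: continuous_fst.
    exact: continuous_val.
  apply: (@continuous_comp _ _ _ (push_coords f) (fun y : {ptws W -> R} => y w)).
    exact: continuous_push_coords.
  exact: continuous_ptws_eval.
move=> p; rewrite /continuous_at /=. apply: (@cvgD _ _ _ _ _
    (fun p => (1 - clamp p.2) * push_coords phi (\val p.1) w)
    (fun p => clamp p.2 * push_coords psi (\val p.1) w)).
  apply: cvgM; last exact: cp.
  by apply: cvgB; [exact: cvg_cst|exact: ct].
by apply: cvgM; [exact: ct|exact: cp].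
Qed.

End RealizationMap.

Arguments realization_map R {V W K L phi} phiS x.

(** * Crosspolytopes and spheres *)

Section Crosspolytope.
Variable m : nat.

(** The boundary of the crosspolytope in dimension [m.+1]: [(true, i)] and [(false, i)] stand for
    the antipodal vertices e_i and -e_i. *)
Definition crosspolytope_simplex (s : {set bool * 'I_m.+1}) : Prop :=
  s != finset.set0 /\ forall i, (true, i) \in s -> (false, i) \in s -> False.

Lemma crosspolytope_neq0 s : crosspolytope_simplex s -> s != finset.set0.
Proof. by case. Qed.

Lemma crosspolytope_face (s t : {set bool * 'I_m.+1}) :
  crosspolytope_simplex s -> t \subset s -> t != finset.set0 ->
  crosspolytope_simplex t.
Proof.
by move=> [_ sP] /fintype.subsetP ts t0; split=> // i /ts si /ts; exact: sP si.
Qed.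

Definition crosspolytope : scomplex (bool * 'I_m.+1)%type :=
  SComplex crosspolytope_neq0 crosspolytope_face.

Variable R : realType.
Local Notation pt := {ptws (bool * 'I_m.+1)%type -> R}.

Lemma sum_bool_pair (f : bool * 'I_m.+1 -> R) :
  \sum_p f p = \sum_i (f (true, i) + f (false, i)).
Proof.
rewrite big_split /= (eq_bigr (fun p => f (p.1, p.2))); last by case.
by rewrite -(pair_bigA _ (fun b i => f (b, i))) /= big_bool.
Qed.

(** The linear map sending the vertices to e_i and -e_i; it carries the realization into the unit
    sphere of the l1 norm. *)
Definition difference (x : pt) (i : 'I_m.+1) : R := x (true, i) - x (false, i).

Definition norm2 (y : 'I_m.+1 -> R) : R := Num.sqrt (\sum_i y i ^+ 2).

Lemma sqr_norm2 (y : 'I_m.+1 -> R) : norm2 y ^+ 2 = \sum_i y i ^+ 2.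
Proof. by rewrite sqr_sqrtr // sumr_ge0 // => i _; exact: sqr_ge0. Qed.

Lemma norm2_eq0 (y : 'I_m.+1 -> R) : norm2 y = 0 -> forall i, y i = 0.
Proof.
move=> y0 i; have := sqr_norm2 y; rewrite y0 expr0n /= => /esym/eqP.
rewrite psumr_eq0 => [/allP/(_ i)|j _]; last exact: sqr_ge0.
by rewrite mem_index_enum sqrf_eq0 => /(_ isT)/eqP.
Qed.

Lemma norm2_gt0 (y : 'I_m.+1 -> R) : \sum_i `|y i| != 0 -> 0 < norm2 y.
Proof.
move=> y1; rewrite lt_neqAle sqrtr_ge0 andbT eq_sym.
by apply: contraNneq y1 => /norm2_eq0 y0; rewrite big1 // => i _; rewrite y0 normr0.
Qed.

Lemma norm1_gt0 (y : 'I_m.+1 -> R) : \sum_i y i ^+ 2 = 1 -> 0 < \sum_i `|y i|.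
Proof.
move=> y1; rewrite lt_neqAle sumr_ge0 // andbT eq_sym.
apply/negP; rewrite psumr_eq0 // => /allP y0.
move/eqP: y1; rewrite big1 ?(eq_sym 0) ?oner_eq0 // => i _.
by apply/eqP; rewrite sqrf_eq0 -normr_eq0; apply: (y0 i); rewrite mem_index_enum.
Qed.

Lemma crosspolytope_coords (x : pt) i : realization R crosspolytope x ->
  x (true, i) = 0 \/ x (false, i) = 0.
Proof.
move=> [_ _ [_ /(_ i)]]; rewrite !inE.
by case: eqP => [|_]; [left|case: eqP => [|_ /(_ isT isT)]; [right|]].
Qed.

Lemma norm_difference (x : pt) i : realization R crosspolytope x ->
  `|difference x i| = x (true, i) + x (false, i).
Proof.
move=> xK; have [x0 _ _] := xK.
case: (crosspolytope_coords i xK) => e; rewrite /difference e ?sub0r ?subr0.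
  by rewrite normrN add0r ger0_norm.
by rewrite addr0 ger0_norm.
Qed.

Lemma norm1_difference (x : pt) : realization R crosspolytope x ->
  \sum_i `|difference x i| = 1.
Proof.
move=> xK; have [_ <- _] := xK; rewrite sum_bool_pair.
by apply: eq_bigr => i _; exact: norm_difference.
Qed.

Definition normalize (x : pt) : 'rV[R]_m.+1 :=
  \row_i (difference x i / norm2 (difference x)).

Lemma norm2_difference_gt0 (x : pt) : realization R crosspolytope x ->
  0 < norm2 (difference x).
Proof. by move=> xK; rewrite norm2_gt0 // norm1_difference // oner_eq0. Qed.

Lemma normalize_sphere (x : pt) : realization R crosspolytope x ->
  sphere R m (normalize x).
Proof.
move=> /norm2_difference_gt0 x0; rewrite /sphere /=.
under eq_bigr do rewrite mxE expr_div_n.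
by rewrite -mulr_suml -sqr_norm2 divff // expf_neq0 // gt_eqF.
Qed.

Definition to_sphere (x : realization R crosspolytope) : sphere R m :=
  SigSub (mem_set (normalize_sphere (set_valP x))).

(** Radial projection back to the l1 sphere: the coordinates at [(true, i)] and [(false, i)] are the
    positive and negative parts of y_i, divided by the l1 norm of [y]. *)
Definition flatten_sphere (y : 'rV[R]_m.+1) : pt := fun p =>
  (`|y ord0 p.2| + (if p.1 then 1 else -1) * y ord0 p.2) / 2
  / \sum_i `|y ord0 i|.

Lemma flatten_sphere_realization (y : 'rV[R]_m.+1) :
  sphere R m y -> realization R crosspolytope (flatten_sphere y).
Proof.
move=> /norm1_gt0 y1.
have y0 p : 0 <= flatten_sphere y p.
  apply: divr_ge0; last exact: ltW.
  apply: divr_ge0 => //.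
  have := ler_norm (y ord0 p.2); have := ler_norm (- y ord0 p.2).
  by rewrite normrN; case: p.1; lra.
have s1 : \sum_v flatten_sphere y v = 1.
  rewrite sum_bool_pair /flatten_sphere /=.
  under eq_bigr do rewrite -mulrDl -mulrDl.
  rewrite -mulr_suml -[RHS](divff (lt0r_neq0 y1)); congr (_ / _).
  by apply: eq_bigr => i _; field.
split=> //; split.
  apply/negP => /eqP e; move: s1; rewrite big1 => [/esym/eqP|v _].
    by rewrite oner_eq0.
  by apply/eqP; move/setP: e => /(_ v); rewrite !inE => /negbFE.
move=> i; rewrite !inE /flatten_sphere /= => yt yf.
case: (lerP 0 (y ord0 i)) => yi.
  by move: yf; rewrite ger0_norm // mulN1r subrr !mul0r eqxx.
by move: yt; rewrite ltr0_norm // mul1r addNr !mul0r eqxx.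
Qed.

Definition of_sphere (y : sphere R m) : realization R crosspolytope :=
  SigSub (mem_set (flatten_sphere_realization (set_valP y))).

Lemma to_sphereK : cancel to_sphere of_sphere.
Proof.
move=> x; apply/val_inj/funext => -[b i]; pose y : pt := \val x.
rewrite -[LHS]/(flatten_sphere (normalize y) (b, i)) -[RHS]/(y (b, i)).
have yK : realization R crosspolytope y := set_valP x.
have c0 := norm2_difference_gt0 yK.
rewrite /flatten_sphere /=; set c := norm2 _ in c0.
(* Since [y] has l1 norm 1 after [difference], its normalization has l1 norm [c^-1], and flattening
   undoes the division by [c]. *)
have E j : `|normalize y ord0 j| = `|difference y j| / c.
  by rewrite mxE normrM normfV (gtr0_norm c0).
under eq_bigr do rewrite E.
rewrite -mulr_suml (norm1_difference yK) E mxE -/c norm_difference //.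
rewrite /difference; have cN := lt0r_neq0 c0.
by case: b => /=; field.
Qed.

Lemma of_sphereK : cancel of_sphere to_sphere.
Proof.
move=> y; apply/val_inj/rowP => i /=; rewrite mxE.
have yS := set_valP y; have s0 := norm1_gt0 yS.
set z := \val y in yS s0 *; set s := \sum_i _ in s0.
have E j : difference (flatten_sphere z) j = z ord0 j / s.
  rewrite /difference /flatten_sphere /= -/s; have := lt0r_neq0 s0 => sN.
  by field.
have -> : norm2 (difference (flatten_sphere z)) = s^-1.
  rewrite /norm2; under eq_bigr do rewrite E expr_div_n.
  by rewrite -mulr_suml yS mul1r sqrtrV ?sqr_ge0 // sqrtr_sqr gtr0_norm.
by rewrite E invrK divfK // gt_eqF.
Qed.

Lemma continuous_to_sphere : continuous to_sphere.
Proof.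
apply: continuous_to_set_type; apply: continuous_to_rV => i.
have cd j : continuous (fun x : realization R crosspolytope => difference (\val x) j).
  have cv p : continuous (fun x : realization R crosspolytope => (\val x : pt) p).
    move=> x; apply: (@continuous_comp _ _ _ set_val (fun y : pt => y p)).
      exact: continuous_val.
    exact: continuous_ptws_eval.
  by move=> x; apply: continuousB; exact: cv.
have E : (fun x => \val (to_sphere x) ord0 i) =
  (fun x : realization R crosspolytope => difference (\val x) i / norm2 (difference (\val x))).
  by apply/funext => x; rewrite /= mxE.
rewrite E; apply: continuous_mulr; first exact: cd.
apply: continuous_invr => [x|x].
  by rewrite gt_eqF // norm2_difference_gt0 //; exact: set_valP.
apply: (@continuous_comp _ _ _ (fun x : realization R crosspolytope =>
  \sum_i difference (\val x) i ^+ 2) Num.sqrt); last exact: sqrt_continuous.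
have -> : (fun x : realization R crosspolytope => \sum_i difference (\val x) i ^+ 2) =
    (fun x => \sum_i difference (\val x) i * difference (\val x) i).
  by apply/funext => z; apply: eq_bigr => j _; rewrite expr2.
by apply: continuous_sumr => j _; apply: continuous_mulr; exact: cd.
Qed.

Lemma continuous_of_sphere : continuous of_sphere.
Proof.
apply: continuous_to_set_type; apply: continuous_to_ptws => p.
have cv j : continuous (fun y : sphere R m => (\val y : 'rV[R]_m.+1) ord0 j).
  move=> x; apply: (@continuous_comp _ _ _ set_val (fun y : 'rV[R]_m.+1 => y ord0 j)).
    exact: continuous_val.
  exact: coord_continuous.
have cn j : continuous (fun y : sphere R m => `|(\val y : 'rV[R]_m.+1) ord0 j|).
  by move=> y; exact: (continuous_comp (cv j y) (@norm_continuous _ R^o _)).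
apply: continuous_mulr; last first.
  apply: continuous_invr => [y|].
    by apply/lt0r_neq0/norm1_gt0; exact: (set_valP y).
  by apply: continuous_sumr => j _; exact: cn.
have cs : continuous (fun y : sphere R m =>
    (if p.1 then 1 else -1) * (\val y : 'rV[R]_m.+1) ord0 p.2).
  by apply: continuous_mulr; [exact: cst_continuous|exact: cv].
apply: (@continuous_mulr _ _ (fun y : sphere R m => `|(\val y : 'rV[R]_m.+1) ord0 p.2|
  + (if p.1 then 1 else -1) * (\val y : 'rV[R]_m.+1) ord0 p.2)); last first.
  exact: cst_continuous.
by apply: continuous_addr; [exact: cn|exact: cs].
Qed.

End Crosspolytope.

(** The maps [q] and [e] are inverse up to homotopy: one composite is the identity by cancellation,
    the other is homotopic to it by hypothesis. Composing with the homeomorphism from the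
    crosspolytope boundary to the sphere gives the equivalence. *)
Lemma homotopy_equivalent_sphere (R : realType) (m : nat) (V : finType)
    (K : scomplex V) (q : V -> bool * 'I_m.+1) (e : bool * 'I_m.+1 -> V)
    (qS : simplicial K (crosspolytope m) q)
    (eS : simplicial (crosspolytope m) K e)
    (eqS : simplicial K K (e \o q))
    (idS : simplicial K K id) :
  cancel e q ->
  globally_homotopic R (realization_map R idS) (realization_map R eqS) ->
  homotopy_equivalent R (realization R K) (sphere R m).
Proof.
move=> eK hom; exists (@to_sphere m R \o realization_map R qS).
exists (realization_map R eS \o @of_sphere m R); split.
- move=> x; apply: continuous_comp; first exact: continuous_realization_map.
  exact: continuous_to_sphere.
- move=> x; apply: continuous_comp; first exact: continuous_of_sphere.
  exact: continuous_realization_map.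
- have -> : (realization_map R eS \o @of_sphere m R) \o
      (@to_sphere m R \o realization_map R qS) = realization_map R eqS.
    rewrite -(realization_map_comp R qS eS eqS); apply/funext => x /=.
    by rewrite to_sphereK.
  rewrite -(realization_map_id R idS) //.
  exact/globally_homotopic_homotopic/globally_homotopic_sym.
- have qeS : simplicial (crosspolytope m) (crosspolytope m) (q \o e).
    by move=> s sC; rewrite imset_comp; apply: qS; apply: eS.
  have -> : (@to_sphere m R \o realization_map R qS) \o
      (realization_map R eS \o @of_sphere m R) = id.
    apply/funext => y /=; rewrite -[RHS]of_sphereK; congr (to_sphere _).
    have /funeqP/(_ (of_sphere y)) /= -> := realization_map_comp R eS qS qeS.
    by rewrite realization_map_id // => s v _ _; exact: eK.
  apply: globally_homotopic_homotopic; apply: globally_homotopic_refl.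
  by move=> x; exact: cvg_id.
Qed.

Lemma homotopy_equivalent_point (R : realType) (V : finType) (K : scomplex V)
    (a : V) (aS : simplicial K K (fun=> a)) (idS : simplicial K K id) :
  vertex K a ->
  globally_homotopic R (realization_map R idS) (realization_map R aS) ->
  homotopy_equivalent R (realization R K) [set (0 : R)].
Proof.
move=> Ka hom.
have xK : realization R K (fun v => (v == a)%:R).
  apply: (realization_of_subsupport Ka).
  - by move=> v; exact: ler0n.
  - by rewrite (bigD1 a) //= eqxx big1 ?addr0 // => v /negbTE ->.
  - by move=> v; rewrite finset.in_set1 => /negbTE ->.
pose x0 : realization R K := SigSub (mem_set xK).
have zP : [set (0 : R)] 0 by [].
pose z0 : [set (0 : R)] := SigSub (mem_set zP).
exists (fun=> z0), (fun=> x0); split.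
- exact: cst_continuous.
- exact: cst_continuous.
- have -> : (fun=> x0) \o (fun=> z0) = realization_map R aS.
    apply/funext => x; apply/val_inj/funext => v /=; rewrite /push_coords.
    have [_ x1 _] := set_valP x.
    have [_|_] := eqVneq v a; last by rewrite big1.
    by rewrite -x1; apply: eq_bigl.
  rewrite -(realization_map_id R idS) //.
  exact/globally_homotopic_homotopic/globally_homotopic_sym.
- have -> : (fun=> z0) \o (fun=> x0) = id.
    by apply/funext => z; apply/val_inj; rewrite /= (set_valP z).
  apply: globally_homotopic_homotopic; apply: globally_homotopic_refl.
  by move=> x; exact: cvg_id.
Qed.

(** * Strong Morse matchings on a path *)

Section PathMatchings.
Variables (R : realType) (n : nat).
Local Notation P := (path_graph n).
Implicit Types (v w a : 'I_n.+1) (g : 'I_n.+1 -> R).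

Definition path_adjacent v w : bool := (v.+1 == w) || (w.+1 == v).

Lemma path_adjacent_neq v w : path_adjacent v w -> w != v.
Proof. by rewrite /path_adjacent -val_eqE /=; lia. Qed.

Lemma path_simplex1 v : P [set v]%SET.
Proof. by left; exists v. Qed.

Lemma path_simplex_card s : P s -> (#|s| <= 2)%N.
Proof.
by case=> [[i ->]|[i [j [_ ->]]]]; rewrite ?cards1 // cards2; case: eqP.
Qed.

Lemma path_edgeP v w : w != v -> P [set v; w]%SET <-> path_adjacent v w.
Proof.
move=> wv; split=> [[[i e]|[i [j [ij e]]]]|/orP[] /eqP e].
- have := finset.set21 v w; have := finset.set22 v w; rewrite e !finset.inE.
  by move=> /eqP wi /eqP vi; rewrite wi vi eqxx in wv.
- have := finset.set21 v w; have := finset.set22 v w; rewrite e !finset.inE.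
  rewrite /path_adjacent -!val_eqE /=; move: wv; rewrite -val_eqE /=; lia.
- by right; exists v, w.
- by right; exists w, v; rewrite finset.setUC.
Qed.

Lemma path_link_simplex v w s : P (v |: s)%SET -> v \notin s -> w \in s ->
  s = [set w]%SET.
Proof.
move=> /path_simplex_card; rewrite cardsU1 => + vs ws; rewrite vs => s1.
by apply/esym/eqP; rewrite eqEcard finset.sub1set ws cards1.
Qed.

(** Combinatorial form of descending domination on a path, where the link of [v] in its sublevel
    complex is the discrete set of lower neighbours. *)
Definition unique_lower_neighbor g v a : Prop :=
  [/\ path_adjacent v a, g a <= g v & forall w, path_adjacent v w -> g w <= g v -> w = a].

Lemma sublevel_edge g v w : path_adjacent v w -> g w <= g v ->
  sublevel P g v [set v; w]%SET.
Proof.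
move=> vw gw; split; first by apply/path_edgeP => //; exact: path_adjacent_neq.
by move=> u; rewrite !finset.inE => /orP[] /eqP ->.
Qed.

Lemma link_singleton g v w : path_adjacent v w -> g w <= g v ->
  link v (sublevel P g v) [set w]%SET.
Proof.
move=> vw gw; split; last exact: sublevel_edge.
- by split=> [|u]; [exact: path_simplex1|rewrite finset.inE => /eqP ->].
- by rewrite finset.inE eq_sym path_adjacent_neq.
Qed.

(** Simplices of a path have at most two vertices, so the link contains only singletons, and such a
    link is a cone exactly when it is one point. *)
Lemma descending_dominated_byP g v a :
  descending_dominated_by P g v a <-> unique_lower_neighbor g v a.
Proof.
split=> [[av [K0 [_ E]]]|[va ga aP]].
- have : cone a K0 [set a]%SET by apply: Or31.
  rewrite -E => -[_ _ [/(path_edgeP av) va /(_ a)]].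
  rewrite finset.set22 => /(_ isT) ga.
  split=> // w vw gw; have := link_singleton vw gw; rewrite E => -[].
  + exact: finset.set1_inj.
  (* A base vertex [w] puts {a, w} into the link, so {v, a, w} is a simplex with three vertices
     unless [a = w]. *)
  + move=> K0w; have : cone a K0 (a |: [set w])%SET by apply: Or33; exists [set w]%SET.
    rewrite -E => -[_ vN [/path_simplex_card]].
    rewrite cardsU1 vN cards2; case: eqVneq => // <-.
  + by case=> t _ e; have := finset.setU11 a t; rewrite -e finset.inE => /eqP.
- split; first exact: path_adjacent_neq.
  have K0P : forall s t : {set 'I_n.+1}, False -> t \subset s -> t != finset.set0 -> False by [].
  (* A single lower neighbour is the cone over the empty complex. *)
  exists (@SComplex _ (fun _ => False) (fun _ f => False_ind _ f) K0P); split=> //.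
  apply/seteqP; split=> s; last first.
    by case=> [->|//|[]//]; exact: link_singleton.
  case=> -[/simplex_neq0 /finset.set0Pn[w ws] _] vs [Pvs gs]; apply: Or31.
  have es := path_link_simplex Pvs vs ws; rewrite {}es in Pvs gs vs *; congr [set _]%SET.
  apply: aP; last by apply: gs; rewrite finset.set22.
  by apply/path_edgeP => //; rewrite eq_sym; move: vs; rewrite finset.inE.
Qed.

Definition arrow v a : {set 'I_n.+1} * {set 'I_n.+1} :=
  ([set v]%SET, [set a; v]%SET).

Lemma associated_matching_arrow g c M p :
  associated_matching P g c M -> p \in M ->
  exists v a, p = arrow v a /\ unique_lower_neighbor g v a.
Proof.
move=> [cP ME] pM; have : [set` M] p by [].
rewrite ME => -[v [s [/cP/descending_dominated_byP vP [Ps gs] vs cs ->]]].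
exists v, (c v); split=> //; suff -> : s = [set v]%SET by [].
apply/finset.setP => w; rewrite finset.inE; apply/idP/eqP => [ws|-> //].
(* A further vertex [w] of [s] would be a lower neighbour of [v], hence equal to [c v], which [s]
   omits. *)
apply/eqP; apply: contraNT cs => wv; have [_ _ lowP] := vP; rewrite -(lowP w) //; last exact: gs.
apply/(path_edgeP wv); apply: simplex_face Ps _ _.
  by apply/fintype.subsetP => u; rewrite !finset.inE => /orP[] /eqP ->.
by apply/finset.set0Pn; exists v; rewrite finset.set21.
Qed.

Lemma exists_matching g : injective g -> exists2 M, strong_Morse_matching R P M &
  forall v a, unique_lower_neighbor g v a -> arrow v a \in M.
Proof.
(* The default [v] is returned only where [v] is not descending dominated. *)
move=> gI; pose c v := xget v [set a | descending_dominated_by P g v a].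
have cP v a : descending_dominated_by P g v a -> descending_dominated_by P g v (c v).
  exact: xgetI.
pose Q p := exists v (s : {set 'I_n.+1}), [/\ descending_dominated P g v,
  sublevel P g v s, v \in s, c v \notin s & p = (s, (c v |: s)%SET)].
exists (finset (fun p => `[< Q p >])).
  exists g, c; split=> [v w _ _ /gI //|]; split=> [v [a]|]; first exact: cP.
  by apply/seteqP; split=> p; rewrite /= finset.inE => /asboolP.
move=> v a va; have /cP cv := (descending_dominated_byP g v a).2 va.
have [vc _ _] := (descending_dominated_byP g v (c v)).1 cv.
have ca : c v = a.
  have [_ gc _] := (descending_dominated_byP g v (c v)).1 cv.
  by case: va => _ _; apply.
rewrite finset.inE; apply/asboolP; exists v, [set v]%SET; split.
- by exists (c v).
- by split=> [|w]; [exact: path_simplex1|rewrite finset.inE => /eqP ->].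
- exact: finset.set11.
- by rewrite finset.inE path_adjacent_neq.
- by rewrite ca.
Qed.

(** Every element of ['I_n.+1] is a vertex of the path, so a filtration is an injective map;
    uniqueness of the lower neighbour removes the choice of dominating vertices. *)
Lemma SM_path_simplexP S : SM R P S <-> S != finset.set0 /\
  exists2 g, injective g & forall p, p \in S ->
    exists v a, p = arrow v a /\ unique_lower_neighbor g v a.
Proof.
split=> [[S0 [M [g [c [gI gM]]] SM]]|[S0 [g gI gS]]]; split=> //.
  exists g => [v w|p /(fintype.subsetP SM)]; last exact: (associated_matching_arrow gM).
  by apply: gI; exact: path_simplex1.
have [M MP Ma] := exists_matching gI; exists M => //.
by apply/fintype.subsetP => p /gS[v [a [-> /Ma]]].
Qed.

End PathMatchings.

(** * The complex as the independence complex of a graph on edge codes *)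

Definition compatible (t u : bool * nat) : bool :=
  match t, u with
  | (true, i), (false, j) => ~~ (i <= j <= i.+2)%N
  | (false, j), (true, i) => ~~ (i <= j <= i.+2)%N
  | _, _ => true
  end.

Lemma compatible_sym t u : compatible t u = compatible u t.
Proof. by case: t u => [[] i] [[] j]. Qed.

Section Codes.
Variables (R : realType) (n : nat).
Local Notation K := (SM R (path_graph n)).

(* The edge {i, i+1} with i = t.2, matched to i+1 (L_i) if t.1 and to i (R_i) otherwise. *)
Definition edge_pair (t : bool * nat) : {set 'I_n.+1} * {set 'I_n.+1} :=
  if t.1 then arrow (inord t.2.+1) (inord t.2) else arrow (inord t.2) (inord t.2.+1).

Lemma arrow_inj (v a w b : 'I_n.+1) : a != v -> b != w ->
  arrow v a = arrow w b -> v = w /\ a = b.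
Proof.
move=> av bw [/finset.set1_inj <- e]; split=> //.
have := finset.set21 a v; rewrite e !finset.inE (negbTE av) orbF.
by move/eqP.
Qed.

Lemma inord_inj i j : (i <= n)%N -> (j <= n)%N -> @inord n i = inord j -> i = j.
Proof. by move=> iN jN /(congr1 val); rewrite /= !inordK. Qed.

Lemma inord_neq i j : (i <= n)%N -> (j <= n)%N -> i != j -> @inord n i != inord j.
Proof. by move=> iN jN; apply: contraNneq => /inord_inj ->. Qed.

Lemma edge_pair_inj t u : (t.2 < n)%N -> (u.2 < n)%N ->
  edge_pair t = edge_pair u -> t = u.
Proof.
rewrite /edge_pair; case: t u => [[] i] [[] j] /= iN jN /arrow_inj [];
  try (apply: inord_neq; lia).
- by move=> _ /inord_inj -> //; lia.
- by move=> /inord_inj E /inord_inj F; have := E iN (ltnW jN); have := F (ltnW iN) jN; lia.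
- by move=> /inord_inj E /inord_inj F; have := E (ltnW iN) jN; have := F iN (ltnW jN); lia.
- by move=> /inord_inj -> //; lia.
Qed.

Lemma edge_pair_of_arrow (v a : 'I_n.+1) : path_adjacent v a ->
  exists2 t, (t.2 < n)%N & arrow v a = edge_pair t.
Proof.
case/orP=> /eqP e.
  exists (false, v : nat); first by rewrite /= -ltnS e.
  by rewrite /edge_pair /= e !inord_val.
exists (true, a : nat); first by rewrite /= -ltnS e.
by rewrite /edge_pair /= e !inord_val.
Qed.

Section Filtration.
Variable g : 'I_n.+1 -> R.
Local Notation G i := (g (inord i)).

(** The guard [i.+1 < n] expresses that [i.+1] has a second neighbour [i.+2], which then has to lie
    strictly higher. *)
Lemma lower_neighbor_true i : (i < n)%N ->
  unique_lower_neighbor g (inord i.+1) (inord i) <->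
  G i <= G i.+1 /\ ((i.+1 < n)%N -> G i.+1 < G i.+2).
Proof.
move=> iN; split=> [[_ gi lowi]|[gi gi1]].
  split=> // iN1; rewrite ltNge; apply/negP => /lowi.
  rewrite /path_adjacent !inordK ?eqxx //; try lia.
  by move=> /(_ isT)/inord_inj; lia.
split=> [|//|w]; rewrite /path_adjacent !inordK //; try lia.
case/orP=> /eqP; last by move=> [<-] _; rewrite inord_val.
move=> e; have := ltn_ord w; rewrite -e => /gi1; rewrite e inord_val.
by rewrite leNgt => ->.
Qed.

Lemma lower_neighbor_false j : (j < n)%N ->
  unique_lower_neighbor g (inord j) (inord j.+1) <->
  G j.+1 <= G j /\ ((0 < j)%N -> G j < G j.-1).
Proof.
move=> jN; split=> [[_ gj lowj]|[gj gj1]].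
  split=> // j0; rewrite ltNge; apply/negP => /lowj.
  rewrite /path_adjacent !inordK ?prednK ?eqxx ?orbT //; try lia.
  by move=> /(_ isT)/inord_inj; lia.
split=> [|//|w]; rewrite /path_adjacent !inordK ?eqxx //; try lia.
case/orP=> /eqP; first by move=> e _; rewrite e inord_val.
move=> e; have := gj1; rewrite -e /= inord_val => /(_ isT).
by rewrite leNgt => ->.
Qed.

End Filtration.

Lemma edge_pair_lower_neighbor (g : 'I_n.+1 -> R) t : (t.2 < n)%N ->
  (exists v a, edge_pair t = arrow v a /\ unique_lower_neighbor g v a) <->
  if t.1 then unique_lower_neighbor g (inord t.2.+1) (inord t.2)
  else unique_lower_neighbor g (inord t.2) (inord t.2.+1).
Proof.
case: t => b i /= iN; split=> [[v [a [e va]]]|].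
  have [vaA _ _] := va; have av := path_adjacent_neq vaA.
  rewrite /edge_pair in e; case: b e => /= /arrow_inj [] //; try (apply: inord_neq; lia).
    by move=> -> ->.
  by move=> -> ->.
by case: b => h; [exists (inord i.+1), (inord i)|exists (inord i), (inord i.+1)].
Qed.

(** For [j = i] the edge would be level, against injectivity. For [j = i.+1] and [j = i.+2] the edge
    {i+1, i+2} would have to ascend and descend at once. *)
Lemma compatible_of_filtration (g : 'I_n.+1 -> R) i j : injective g ->
  (i < n)%N -> (j < n)%N ->
  unique_lower_neighbor g (inord i.+1) (inord i) ->
  unique_lower_neighbor g (inord j) (inord j.+1) -> ~~ (i <= j <= i.+2)%N.
Proof.
move=> gI iN jN /(lower_neighbor_true _ iN)[gi gi1] /(lower_neighbor_false _ jN)[gj gj1].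
apply/negP => ij; have [ji|[ji|ji]] : j = i \/ j = i.+1 \/ j = i.+2 by lia.
- subst j; have /gI/inord_inj : g (inord i) = g (inord i.+1).
    by apply/eqP; rewrite eq_le gi gj.
  lia.
- subst j; have := lt_le_trans (gi1 jN) gj; by rewrite ltxx.
- subst j; have := lt_trans (gi1 (ltnW jN)) (gj1 isT); by rewrite ltxx.
Qed.

(* The sign of the value at v decides whether the edge {v-1, v} ascends to v,
   and the absolute value v makes the function injective. *)
Definition signed_height (x : nat -> bool) (v : 'I_n.+1) : R :=
  if (0 < v)%N && ~~ x v.-1 then - (v%:R) else v%:R.

Lemma norm_signed_height x v : `|signed_height x v| = v%:R.
Proof. by rewrite /signed_height; case: ifP; rewrite ?normrN normr_nat. Qed.

Lemma signed_height_inj x : injective (signed_height x).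
Proof.
move=> v w /(congr1 Num.norm); rewrite !norm_signed_height => /eqP.
by rewrite eqr_nat => /eqP; exact: val_inj.
Qed.

Lemma signed_heightS (x : nat -> bool) i : (i < n)%N -> signed_height x (inord i.+1) =
  if x i then i.+1%:R else - i.+1%:R.
Proof. by move=> iN; rewrite /signed_height inordK //=; case: (x i). Qed.

Lemma signed_height_le x i : (i <= n)%N -> - i%:R <= signed_height x (inord i) <= i%:R.
Proof. by move=> iN; rewrite -ler_norml norm_signed_height inordK. Qed.

(** The complex is flag: each pair only prescribes directions of edges, and a conflict is an edge
    prescribed both ways, which already involves just two pairs. Without conflict, [signed_height]
    realizes all prescriptions. *)
Lemma SM_edge_pairP S : K S <-> S != finset.set0 /\
  [/\ forall p, p \in S -> exists2 t, (t.2 < n)%N & p = edge_pair t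
    & forall t u, (t.2 < n)%N -> (u.2 < n)%N ->
        edge_pair t \in S -> edge_pair u \in S -> compatible t u].
Proof.
split=> [/SM_path_simplexP[S0 [g gI gS]]|[S0 [Sc Sp]]].
  split=> //; split=> [p /gS[v [a [-> []]]]|]; first by move=> /edge_pair_of_arrow.
  have low t (tN : (t.2 < n)%N) (tS : edge_pair t \in S) :=
    (edge_pair_lower_neighbor g tN).1 (gS _ tS).
  case=> [[] i] [[] j] //= iN jN /low-/(_ iN) /= lowi /low-/(_ jN) /= lowj.
    exact: compatible_of_filtration gI _ _ lowi lowj.
  exact: compatible_of_filtration gI _ _ lowj lowi.
apply/SM_path_simplexP; split=> //.
(* [x i] tells that the edge {i, i+1} ascends. L_i requires this of the edges [i] and [i.+1], so
   edge [i] is forced by L_i or L_{i-1}; all other edges descend. *)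
pose x i := (edge_pair (true, i) \in S) || ((0 < i)%N && (edge_pair (true, i.-1) \in S)).
exists (signed_height x); first exact: signed_height_inj.
move=> p pS; have [[b i] /= iN e] := Sc _ pS; rewrite e in pS *.
apply/edge_pair_lower_neighbor => //; case: b pS {e} => pS /=.
  have xi : x i by rewrite /x pS.
  have xi1 : x i.+1 by rewrite /x /= pS orbT.
  apply/(lower_neighbor_true _ iN); rewrite signed_heightS // xi; split=> [|iN1].
    have /andP[_ h] := signed_height_le x (ltnW iN); apply: le_trans h _.
    by rewrite ler_nat.
  by rewrite signed_heightS // xi1 ltr_nat.
(* R_i requires the edges [i.-1] and [i] to descend. They could ascend only because of L_{i-2},
   L_{i-1} or L_i, all incompatible with R_i. *)
have xi j : (j <= i <= j.+1)%N -> x j = false.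
  move=> ji; rewrite /x; apply/negbTE/norP; split.
    by apply/negP => /(Sp (false, i) (true, j)) /=; lia.
  apply/nandP; case: j ji => [|j] ji; first by left.
  by right; apply/negP => /(Sp (false, i) (true, j)) /=; lia.
apply/(lower_neighbor_false _ iN); rewrite signed_heightS // xi; last lia.
split=> [|i0].
  have /andP[+ _] := signed_height_le x (ltnW iN); apply: le_trans.
  by rewrite lerN2 ler_nat.
case: i i0 {pS} iN xi => // i _ iN xi; rewrite signed_heightS ?xi; try lia.
have /andP[h _] := signed_height_le x (ltnW (ltnW iN)).
by apply: lt_le_trans h; rewrite ltrN2 ltr_nat.
Qed.

End Codes.

(** * Folding *)

(** The total effect of the folds; it fixes L_{4q}, L_{4q+1}, R_{4q} and R_{4q+3}. *)
Definition collapse (t : bool * nat) : bool * nat :=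
  if t.1 then (true, if (1 < t.2 %% 4)%N then 4 * (t.2 %/ 4) + 1 else t.2)%N
  else (false, if (0 < t.2 %% 4 < 3)%N then 4 * (t.2 %/ 4) else t.2)%N.

(* Two thresholds, because the folds have to be interleaved: R_{4q+1} is dominated
   by R_{4q} only once L_{4q-2} has been moved away, and L_{4q+2} is dominated by
   L_{4q+1} only once R_{4q+1} has been moved away. *)
Definition partial_collapse (l h : nat) (t : bool * nat) : bool * nat :=
  if (t.2 < if t.1 then l else h)%N then collapse t else t.

Section Collapse.
Variables (R : realType) (n : nat).
Hypothesis n_gt0 : (0 < n)%N.
Local Notation K := (SM R (path_graph n)).

(** The default code has index 0, which is below [n] as [n] is positive, so codes are in range even
    for elements that are not vertices. *)
Definition edge_code (p : {set 'I_n.+1} * {set 'I_n.+1}) : bool * nat :=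
  if [pick t : bool * 'I_n | edge_pair n (t.1, val t.2) == p] is Some t
  then (t.1, val t.2) else (true, 0%N).

Lemma edge_pairK t : (t.2 < n)%N -> edge_code (edge_pair n t) = t.
Proof.
case: t => b i /= iN; rewrite /edge_code; case: pickP => [[c j] /= /eqP e|].
  by apply: edge_pair_inj e => //=; exact: ltn_ord.
by move=> /(_ (b, Ordinal iN)) /=; rewrite eqxx.
Qed.

Lemma edge_code_lt p : ((edge_code p).2 < n)%N.
Proof. by rewrite /edge_code; case: pickP => [[c j] _ /=|]. Qed.

Lemma edge_codeK S p : K S -> p \in S -> edge_pair n (edge_code p) = p.
Proof. by move=> /SM_edge_pairP[_ [Sc _]] /Sc[t tN ->]; rewrite edge_pairK. Qed.

Lemma edge_code_compatible S p q : K S -> p \in S -> q \in S ->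
  compatible (edge_code p) (edge_code q).
Proof.
move=> KS pS qS; have /SM_edge_pairP[_ [_ Sp]] := KS.
by apply: Sp; rewrite ?edge_code_lt // (edge_codeK KS).
Qed.

Definition induced (f : bool * nat -> bool * nat) (p : {set 'I_n.+1} * {set 'I_n.+1}) :=
  edge_pair n (f (edge_code p)).

(** As the complex is flag, contiguity can be checked on two codes at a time. *)
Lemma induced_contiguous (f f' : bool * nat -> bool * nat) :
  (forall t, (t.2 < n)%N -> ((f t).2 < n)%N) ->
  (forall t, (t.2 < n)%N -> ((f' t).2 < n)%N) ->
  (forall t u, (t.2 < n)%N -> (u.2 < n)%N -> compatible t u ->
    [/\ compatible (f t) (f u), compatible (f t) (f' u)
      & compatible (f' t) (f' u)]) ->
  contiguous K K (induced f) (induced f').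
Proof.
move=> fN f'N ff' S KS; apply/SM_edge_pairP; split.
  by have /set0Pn[p pS] := imset_simplex_neq0 (induced f) KS;
    apply/set0Pn; exists p; rewrite finset.inE pS.
have im p : p \in ((induced f @: S) :|: (induced f' @: S))%SET ->
    exists q, q \in S /\ (p = induced f q \/ p = induced f' q).
  by rewrite finset.inE => /orP[] /imsetP[q qS ->]; exists q; split; auto.
have cN q : ((edge_code q).2 < n)%N := edge_code_lt q.
split=> [p /im[q [qS [|]] ->]|t u tN uN /im[p [pS pe]] /im[q [qS qe]]].
- by exists (f (edge_code q)); rewrite ?fN.
- by exists (f' (edge_code q)); rewrite ?f'N.
- have cpq := edge_code_compatible KS pS qS.
  have [c1 c2 c3] := ff' _ _ (cN p) (cN q) cpq.
  (* The mixed condition is not symmetric in the two codes, so it is also taken with [p] and [q]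
     exchanged. *)
  have [_ c4 _] := ff' _ _ (cN q) (cN p) (edge_code_compatible KS qS pS).
  by case: pe qe => /edge_pair_inj-> //; rewrite ?fN ?f'N //;
    case=> /edge_pair_inj-> //; rewrite ?fN ?f'N // compatible_sym.
Qed.

Lemma partial_collapse_lt l h t : (t.2 < n)%N -> ((partial_collapse l h t).2 < n)%N.
Proof.
case: t => [[] i] /=; rewrite /partial_collapse /collapse /=;
  case: ifP => //= _; case: ifP => //=; lia.
Qed.

(** With L_{4q-2} and L_{4q-1} moved away, the only remaining neighbour of R_{4q} is L_{4q}, which
    is also adjacent to R_{4q+1} and R_{4q+2}; hence both can be folded onto R_{4q}. *)
Lemma partial_collapse_false_step q :
  contiguous K K (induced (partial_collapse (4 * q) (4 * q)))
    (induced (partial_collapse (4 * q) (4 * q + 4))).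
Proof.
apply: induced_contiguous; try exact: partial_collapse_lt.
case=> [[] i] [[] j] /= iN jN ij; rewrite /partial_collapse /collapse /=.
- by repeat (case: ifP => //= ?).
- split; repeat (case: ifP => //= ?); lia.
- split; repeat (case: ifP => //= ?); lia.
- by repeat (case: ifP => //= ?).
Qed.

(** With R_{4q+1} and R_{4q+2} moved away, L_{4q+1} is adjacent at most to R_{4q+3}, a neighbour of
    L_{4q+2} and L_{4q+3} as well; hence both can be folded onto L_{4q+1}. *)
Lemma partial_collapse_true_step q :
  contiguous K K (induced (partial_collapse (4 * q) (4 * q + 4)))
    (induced (partial_collapse (4 * q + 4) (4 * q + 4))).
Proof.
apply: induced_contiguous; try exact: partial_collapse_lt.
case=> [[] i] [[] j] /= iN jN ij; rewrite /partial_collapse /collapse /=.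
- by repeat (case: ifP => //= ?).
- split; repeat (case: ifP => //= ?); lia.
- split; repeat (case: ifP => //= ?); lia.
- by repeat (case: ifP => //= ?).
Qed.

Lemma homotopic_induced_collapse (idS : simplicial K K id)
    (cS : simplicial K K (induced collapse)) :
  globally_homotopic R (realization_map R idS) (realization_map R cS).
Proof.
have pcS q := contiguous_simplicial (partial_collapse_false_step q).
have step q : globally_homotopic R (realization_map R (pcS q)) (realization_map R (pcS q.+1)).
  have e : (4 * q.+1 = 4 * q + 4)%N by lia.
  move: (pcS q.+1); rewrite e => S1.
  have S2 := contiguous_simplicial (contiguous_sym (partial_collapse_false_step q)).
  apply: (@globally_homotopic_trans _ _ _ _ (realization_map R S2)).
    exact: contiguous_homotopic (partial_collapse_false_step q).
  exact: contiguous_homotopic (partial_collapse_true_step q).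
have all q : globally_homotopic R (realization_map R idS) (realization_map R (pcS q)).
  (* With both thresholds 0 nothing moves, so the induced map agrees with the identity on
     simplices. *)
  elim: q => [|q IH]; last exact: globally_homotopic_trans IH (step q).
  apply: contiguous_homotopic; apply: contiguous_eq => // s p Ks ps.
  rewrite /induced -{1}(edge_codeK Ks ps); congr edge_pair.
  by rewrite /partial_collapse if_same.
(* After [n] rounds the thresholds [4 * n] exceed every index, so the folding is complete. *)
apply: globally_homotopic_trans (all n) _.
apply: contiguous_homotopic; apply: contiguous_eq => // s p Ks ps.
rewrite /induced /partial_collapse if_same ifT //.
by have := edge_code_lt p; lia.
Qed.

Lemma collapse_lt t : (t.2 < n)%N -> ((collapse t).2 < n)%N.
Proof. by case: t => [[] i] /=; rewrite /collapse /=; case: ifP => //=; lia. Qed.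

Lemma collapse_compatible t u : compatible t u -> compatible (collapse t) (collapse u).
Proof.
case: t u => [[] i] [[] j] //=; rewrite /collapse /=;
  repeat (case: ifP => //= ?); lia.
Qed.

Lemma simplicial_induced_collapse : simplicial K K (induced collapse).
Proof.
apply: (@contiguous_simplicial _ _ _ _ _ (induced collapse)).
apply: induced_contiguous; try exact: collapse_lt.
by move=> t u _ _ /collapse_compatible tu; split.
Qed.

(** * Homotopy type of the folded complex *)

Lemma SM_path_contractible k : n = (4 * k + 2)%N \/ n = (4 * k + 3)%N ->
  homotopy_equivalent R (realization R K) [set (0 : R)].
Proof.
(* The only possible neighbour of L_{4k+1} after folding is R_{4k+3}, whose index is out of range.
   Hence [collapse] is contiguous to the constant map at L_{4k+1}. *)
move=> nk; pose a := edge_pair n (true, 4 * k + 1)%N.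
have c : contiguous K K (induced collapse) (fun=> a).
  apply: (@induced_contiguous collapse (fun=> (true, 4 * k + 1)%N)).
  - exact: collapse_lt.
  - by move=> t _ /=; lia.
  - move=> t u tN uN /collapse_compatible tu; split=> //.
    by case: t tN {tu} => [[] i] //=; rewrite /collapse /=; case: ifP => /=; lia.
have aS := contiguous_simplicial (contiguous_sym c).
apply: (@homotopy_equivalent_point R _ K a aS (@simplicial_id _ K)).
  apply/SM_edge_pairP; split.
    by apply/set0Pn; exists a; exact: finset.set11.
  split=> [p|t u tN uN].
    by rewrite finset.inE => /eqP ->; exists (true, 4 * k + 1)%N => //=; lia.
  rewrite !finset.inE => /eqP/edge_pair_inj-> //=; last lia.
  by move=> /eqP/edge_pair_inj-> //=; lia.
apply: (@globally_homotopic_trans _ _ _ _ (realization_map R simplicial_induced_collapse)).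
  exact: homotopic_induced_collapse.
exact: contiguous_homotopic c.
Qed.

(** Numbers the antipodal pairs: [p = 2q] is (L_{4q}, R_{4q}) and [p = 2q+1] is (L_{4q+1},
    R_{4q+3}), with [b] selecting the side. *)
Definition pair_position (b : bool) (p : nat) : nat :=
  (4 * p./2 + odd p * (if b then 1 else 3))%N.

Definition pair_index (t : bool * nat) : nat :=
  (2 * (t.2 %/ 4) + if t.1 then 0 < t.2 %% 4 else t.2 %% 4 == 3)%N.

Lemma pair_positionK b p : pair_index (b, pair_position b p) = p.
Proof.
rewrite /pair_index /pair_position.
by case: b; case: (odd p) (odd_double_half p) => /=; lia.
Qed.

Lemma collapseE t : collapse t = (t.1, pair_position t.1 (pair_index t)).
Proof.
have := odd_double_half (pair_index t); move: (odd _) => o.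
case: t => [[] i]; rewrite /collapse /pair_position /pair_index /= => h; congr pair.
  by move: h; case: o; case: ifP; case: (ltnP 0 (i %% 4)%N) => /=; lia.
by move: h; case: o; case: ifP; case: eqP => /=; lia.
Qed.

(** Index [2q] collects L_{4q} and its neighbours R_{4q}, R_{4q+1}, R_{4q+2}; index [2q+1] collects
    R_{4q+3} and its neighbours L_{4q+1}, L_{4q+2}, L_{4q+3}. No simplex therefore meets both sides
    of one index. *)
Lemma pair_index_compatible i j :
  pair_index (true, i) = pair_index (false, j) -> ~~ compatible (true, i) (false, j).
Proof.
by rewrite /pair_index /=; case: eqP; case: ltnP => /=; lia.
Qed.

Lemma pair_position_compatible p q : p != q ->
  compatible (true, pair_position true p) (false, pair_position false q).
Proof.
rewrite /pair_position /=; have := odd_double_half p; have := odd_double_half q.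
by case: (odd p); case: (odd q) => /=; lia.
Qed.

(** The hypotheses say that the pairs numbered 0 to [m] all fit into the path and that every edge
    folds into one of them. The folded complex is then the crosspolytope boundary on these [m.+1]
    pairs. *)
Lemma SM_path_sphere m :
  (forall b p, (p <= m)%N -> (pair_position b p < n)%N) ->
  (forall t, (t.2 < n)%N -> (pair_index t <= m)%N) ->
  homotopy_equivalent R (realization R K) (sphere R m).
Proof.
move=> posN indN.
pose e (x : bool * 'I_m.+1) := edge_pair n (x.1, pair_position x.1 x.2).
pose q p : bool * 'I_m.+1 := ((edge_code p).1, inord (pair_index (edge_code p))).
have eN (x : bool * 'I_m.+1) : (pair_position x.1 x.2 < n)%N.
  by apply: posN; rewrite -ltnS; exact: ltn_ord.
have eK : cancel e q.
  move=> [b p]; rewrite /q /e edge_pairK //=; last exact: (eN (b, p)).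
  by rewrite pair_positionK inord_val.
(* Reading off side and index and then returning to the representative is exactly the folding. *)
have eqE p : (e \o q) p = induced collapse p.
  by rewrite /induced collapseE /e /q /= inordK // ltnS indN // edge_code_lt.
have qS : simplicial K (crosspolytope m) q.
  move=> S KS; split; first exact: imset_simplex_neq0 KS.
  move=> i /imsetP[p pS [bp ip]] /imsetP[p' p'S [bp' ip']].
  have := edge_code_compatible KS pS p'S; apply/negP.
  move: ip; rewrite ip' => /inord_inj.
  have := edge_code_lt p; have := edge_code_lt p'.
  case: (edge_code p) (edge_code p') bp bp' => [b j] [b' j'] /= <- <- jN j'N E.
  apply: pair_index_compatible; apply/esym/E; exact: indN.
have eS : simplicial (crosspolytope m) K e.
  move=> S cS; apply/SM_edge_pairP; split; first exact: imset_simplex_neq0 cS.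
  have [_ Sp] := cS; split=> [p /imsetP[x xS ->]|t u tN uN].
    by exists (x.1, pair_position x.1 x.2); first exact: eN.
  move=> /imsetP[x xS /edge_pair_inj->] //; last exact: eN.
  move=> /imsetP[y yS /edge_pair_inj->] //; last exact: eN.
  have ne (i j : 'I_m.+1) : (true, i) \in S -> (false, j) \in S -> val i != val j.
    by move=> iS jS; apply/eqP => /val_inj ij; apply: (Sp i) => //; rewrite ij.
  case: x xS => [[] i] iS; case: y yS => [[] j] jS //.
    exact/pair_position_compatible/ne.
  by rewrite compatible_sym; exact/pair_position_compatible/ne.
have eqS : simplicial K K (e \o q).
  by move=> S KS; rewrite imset_comp; exact/eS/qS.
apply: (@homotopy_equivalent_sphere R m _ K q e qS eS eqS (@simplicial_id _ K)) => //.
apply: globally_homotopic_trans.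
  exact: (homotopic_induced_collapse _ simplicial_induced_collapse).
apply: contiguous_homotopic; apply: contiguous_eq => [|s p _ _]; last by rewrite eqE.
exact: simplicial_induced_collapse.
Qed.

End Collapse.

Theorem theorem6p6 (R : realType) (n : nat) (hn : (4 <= n)%N) :
  [/\ forall k : nat, n = (4 * k)%N ->
        homotopy_equivalent R
          (realization R (SM R (path_graph n))) (sphere R (2 * k - 1)%N),
      forall k : nat, n = (4 * k + 1)%N ->
        homotopy_equivalent R
          (realization R (SM R (path_graph n))) (sphere R (2 * k)%N)
    & forall k : nat, n = (4 * k + 2)%N \/ n = (4 * k + 3)%N ->
        homotopy_equivalent R
          (realization R (SM R (path_graph n))) [set (0 : R)]].
Proof.
have n0 : (0 < n)%N by apply: leq_trans hn.
split=> k nk; last exact: (@SM_path_contractible R n n0 k nk).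
(* For [n = 4k] each block of four edges gives two pairs, numbered up to [2 * k - 1]; this
   subtraction is not truncated because [hn] gives [k >= 1]. *)
- apply: (@SM_path_sphere R n n0) => // [b p pm|[b i] /= iN].
    rewrite /pair_position; have := odd_double_half p.
    by case: b; case: (odd p) => /=; lia.
  by rewrite /pair_index /=; case: b; [case: ltnP|case: eqP] => /=; lia.
(* The extra edge [4 * k] adds the pair (L_{4k}, R_{4k}), numbered [2 * k]. *)
- apply: (@SM_path_sphere R n n0) => // [b p pm|[b i] /= iN].
    rewrite /pair_position; have := odd_double_half p.
    by case: b; case: (odd p) => /=; lia.
  by rewrite /pair_index /=; case: b; [case: ltnP|case: eqP] => /=; lia.
Qed.
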